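(* Let $1\le p<r\le\infty$ and let $r'$ be the conjugate index of $r$, $\frac1r+\frac1{r'}=1$. Let $T:AC_r\to AC_p$ be a multiplier given by $Tg=mg$, $g\in AC_r$, with $m:(0,1]\to\mathbb{C}$ continuous. Then for each $\epsilon\in(0,1)$, $m$ is absolutely continuous on $[\epsilon,1]$, $m'\in L^p[\epsilon,1]$, and $$\|m'\chi_{[\epsilon,1]}\|_p=O(\epsilon^{-1/r'}),$$ i.e. there is a constant $A$ with $\|m'\chi_{[\epsilon,1]}\|_p\le A\,\epsilon^{-1/r'}$ for all $\epsilon\in(0,1)$.
   Context: For $1\le p\le\infty$, $AC_p$ denotes the algebra (under pointwise operations) of absolutely continuous functions $f:[0,1]\to\mathbb{C}$ with $f(0)=0$ and $f'\in L^p[0,1]$, with norm $|||f|||=\|f'\|_p$. A multiplier $T:AC_r\to AC_p$ is a map given by a continuous (not necessarily bounded) function $m:(0,1]\to\mathbb{C}$ via $Tg=mg$, where $mg\in AC_p$ for every $g\in AC_r$; here $mg$ denotes the function on $[0,1]$ equal to $m(t)g(t)$ for $t\in(0,1]$ and to $0$ at $t=0$. $\chi_E$ is the indicator function of $E$. For $r=\infty$, $r'=1$. *)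

(* Defs.v *)
(* MathComp-Analysis over an abstract [R : realType], with the complex numbers
   of mathcomp-real-closed. *)
From HB Require Import structures.
From mathcomp Require Import all_boot all_order all_algebra.
From mathcomp Require Import all_classical all_reals all_analysis.
From mathcomp Require Import complex.

Set Implicit Arguments.
Unset Strict Implicit.
Unset Printing Implicit Defensive.

Import Order.TTheory GRing.Theory Num.Theory.
Import numFieldNormedType.Exports.

Local Open Scope classical_set_scope.
Local Open Scope ring_scope.

(* [Rcomplex R] is the field [R[i]] seen as an [R]-algebra whose modulus [`|z|]
   takes its values in [R]. The instances below equip it with the topology of
   this modulus, so that the library's [continuous], [derivable] and [derive1]
   apply to complex-valued functions of a real variable. *)
Section Rcomplex_normedModType.
Variable R : realType.

Lemma Rcomplex_normrZ (k : R) (z : Rcomplex R) : `|k *: z| = `|k| * `|z|.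
Proof.
case: z => x y; rewrite /Num.norm /= /ComplexField.Normc.normc /=.
by rewrite !exprMn -mulrDr sqrtrM ?sqr_ge0// sqrtr_sqr.
Qed.

HB.instance Definition _ :=
  PseudoMetric.copy (Rcomplex R) (pseudoMetric_normed (Rcomplex R)).
HB.instance Definition _ := isPointed.Build (Rcomplex R) 0.
HB.instance Definition _ :=
  NormedZmod_PseudoMetric_eq.Build R (Rcomplex R) erefl.
HB.instance Definition _ :=
  PseudoMetricNormedZmod_Lmodule_isNormedModule.Build R (Rcomplex R)
    Rcomplex_normrZ.

End Rcomplex_normedModType.

(* A function on a subinterval of the line is a total function on [R] of which
   only the values on that subinterval are used. *)
Section AC_spaces.
Variable R : realType.
Local Notation C := (Rcomplex R).
Local Notation mu := (@lebesgue_measure R).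
Implicit Types (f g m : R -> C) (p r : \bar R) (a b : R).

Definition abs_continuous a b f : Prop :=
  forall e : R, 0 < e -> exists2 d : R, 0 < d &
    forall (n : nat) (u v : 'I_n -> R),
      (forall i, a <= u i /\ u i <= v i /\ v i <= b) ->
      trivIset [set: 'I_n] (fun i => `]u i, v i[%classic) ->
      \sum_(i < n) (v i - u i) < d ->
      \sum_(i < n) `|f (v i) - f (u i)| < e.

Definition restr_indic (E : set R) f : R -> C := fun t => \1_E t *: f t.

Definition LpC_norm p f : \bar R := 'N[mu]_p[(fun t => (`|f t|)%:E)]%E.

Definition in_LpC p (E : set R) f : Prop :=
  [/\ measurable_fun E (fun t => complex.Re (f t)),
      measurable_fun E (fun t => complex.Im (f t)) &
      (LpC_norm p (restr_indic E f) < +oo)%E].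

(* [f' \in L^p[a, b]]. The derivative of an absolutely continuous function
   exists almost everywhere; this is what gives a meaning to [f'] as an element
   of [L^p], and it is recorded in the first clause. At the remaining points,
   the library's total derivative [derive1 f] takes a fixed default value. *)
Definition deriv_in_Lp p a b f : Prop :=
  {ae mu, forall t, t \in `[a, b] -> derivable f t 1} /\
  in_LpC p `[a, b] (derive1 f).

Definition AC p f : Prop :=
  [/\ f 0 = 0, abs_continuous 0 1 f & deriv_in_Lp p 0 1 f].

(* [m] is only given on [(0, 1]]; [m g] is [0] at [0]. *)
Definition mult_op m g : R -> C := fun t => if 0 < t then m t * g t else 0.

(* [m] defines a multiplier [AC_r -> AC_p]. *)
Definition multiplier r p m : Prop :=
  {within `]0, 1], continuous m} /\ forall g, AC r g -> AC p (mult_op m g).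

End AC_spaces.

(* Main.v *)
(** A gliding hump replaces the closed graph theorem. Let s = 1/r'. For a scale
   sequence e_{k+1} <= e_k / 2, let h be the sum of disjoint bumps supported in
   ]e_k / 2, 3 e_k / 4[, of height 2^-(k+1) e_k^(s-1); this height puts h in
   L^r. Its primitive G belongs to AC_r, is constant on [e_{k+1}, e_k / 2], and
   its value there is at least a multiple of 2^-k e_{k+1}^s. Hence
   (m G)' = G m' on these intervals: regularity of m away from 0 is inherited
   from m G, and if the claimed bound failed, the scales could be chosen so that
   the norm of (m G)' in L^p exceeds k + 1 on [e_{k+1}, e_k / 2] for every k. *)
Require Import Defs.
From HB Require Import structures.
From mathcomp Require Import all_boot all_order all_algebra.
From mathcomp Require Import all_classical all_reals all_analysis.
From mathcomp Require Import complex.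
From mathcomp Require Import measurable_realfun ess_sup_inf ring lra.

Import Order.TTheory GRing.Theory Num.Theory.
Import numFieldNormedType.Exports.

Local Open Scope classical_set_scope.
Local Open Scope ring_scope.

Set Implicit Arguments.
Unset Strict Implicit.
Unset Printing Implicit Defensive.

(** * Monotonicity and homogeneity of [L^p] norms *)

Section Lnorm_comparison.
Context d (T : measurableType d) (R : realType).
Variable mu : {measure set T -> \bar R}.
Implicit Types f g : T -> R.
Local Open Scope ereal_scope.

Lemma measurable_normr_powR (f : T -> R) (r : R) :
  measurable_fun setT f -> measurable_fun setT (fun x => `|(f x)%:E| `^ r).
Proof.
move=> mf; under eq_fun do rewrite poweR_EFin.
apply/measurable_EFinP.
apply: (measurableT_comp (measurable_powR r)).
exact: measurableT_comp.
Qed.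

Lemma ae_le_Lnorm (p : \bar R) f g : 1 <= p ->
  measurable_fun setT f -> measurable_fun setT g ->
  {ae mu, forall x, (`|f x| <= `|g x|)%R} ->
  'N[mu]_p[EFin \o f] <= 'N[mu]_p[EFin \o g].
Proof.
case: p => [p|_|//].
- rewrite lee_fin => p1 mf mg fg.
  have p0 : (0 < p)%R by exact: lt_le_trans p1.
  rewrite unlock; apply: gt0_ler_poweR.
  + by rewrite invr_ge0 ltW.
  + by rewrite in_itv/= leey andbT integral_ge0// => x _; exact: poweR_ge0.
  + by rewrite in_itv/= leey andbT integral_ge0// => x _; exact: poweR_ge0.
  + apply: ae_ge0_le_integral => //=.
    * exact: measurable_normr_powR.
    * exact: measurable_normr_powR.
    * apply: filterS fg => x fgx _; rewrite lee_fin.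
      by apply: ge0_ler_powR; rewrite ?nnegrE ?(ltW p0).
- move=> mf mg fg; rewrite unlock; case: ifPn => // _.
  by apply: le_ess_sup; apply: filterS fg => x; rewrite lee_fin.
Qed.

Lemma Lnorm_scale (p a : R) f : (1 <= p)%R -> (0 <= a)%R ->
  measurable_fun setT f ->
  'N[mu]_p%:E[EFin \o (fun x => a * f x)%R] = a%:E * 'N[mu]_p%:E[EFin \o f].
Proof.
move=> p1 a0 mf; have p0 : (0 < p)%R by exact: lt_le_trans p1.
rewrite unlock /=.
under eq_integral => x _ do
  rewrite normrM ger0_norm// powRM// EFinM.
rewrite ge0_integralZl//=.
- rewrite poweRM ?lee_fin ?powR_ge0 ?integral_ge0//.
    by rewrite poweR_EFin -powRrM divff ?gt_eqF// powRr1.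
- exact: measurable_normr_powR.
- by rewrite lee_fin powR_ge0.
Qed.

End Lnorm_comparison.

(** * Derivatives of complex-valued functions of a real variable *)

Section Rcomplex_derivatives.
Variable R : realType.
Local Notation C := (Rcomplex R).

Lemma Rcomplex_norm1 : `|1 : C| = 1 :> R.
Proof.
by rewrite /Num.norm /= /ComplexField.Normc.normc /= expr1n expr0n addr0 sqrtr1.
Qed.

Lemma near_eq_derive1 (V : normedModType R) (f g : R -> V) (t : R) :
  (\forall x \near t, f x = g x) -> derive1 f t = derive1 g t.
Proof.
by move=> fg; rewrite !derive1E; apply: near_eq_derive.
Qed.

Lemma derivable_scale (V : normedModType R) (f : R -> V) (c t : R) : c != 0 ->
  derivable (fun x => c *: f x) t 1 -> derivable f t 1.
Proof.
move=> c0 /(@derivableZ _ _ _ _ c^-1); congr (derivable _ _ _).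
by apply/funext => x /=; rewrite /GRing.scale_fun /= scalerA mulVf// scale1r.
Qed.

(** No derivability is assumed: since [c != 0], [f] and its multiple are derivable at the same
    points, and elsewhere both derivatives take the default value 0. *)
Lemma derive1_scale (f : R -> C) (c t : R) : c != 0 ->
  derive1 (fun x => c *: f x) t = c *: derive1 f t.
Proof.
move=> c0; rewrite !derive1E.
have [df|ndf] := pselect (derivable f t 1); first by rewrite deriveZ.
rewrite /derive (dvgP ndf) dvgP ?scaler0//.
by move=> /(derivable_scale c0).
Qed.

Lemma derivable_scaler (V : normedModType R) (G : R -> R) (v : V) (t : R) :
  derivable G t 1 ->
  derivable (fun x => G x *: v) t 1 /\
  derive1 (fun x => G x *: v) t = derive1 G t *: v.
Proof.
move=> dG.
have H : (fun h : R => h^-1 *: (G (h *: 1 + t) *: v - G t *: v)) @ 0^' -->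
    derive1 G t *: v.
  rewrite (_ : (fun _ => _) =
      (fun h => (h^-1 *: (G (h *: 1 + t) - G t)) *: v)); last first.
    by apply/funext => h /=; rewrite -scalerBl scalerA.
  by apply: cvgZr_tmp; rewrite derive1E; exact: dG.
split; first by apply/cvg_ex; exists (derive1 G t *: v).
by rewrite [LHS]derive1E; apply/cvg_lim.
Qed.

End Rcomplex_derivatives.

(** * Moduli of functions cut off by an indicator *)

Section restr_indic_norm.
Variable R : realType.
Local Notation C := (Rcomplex R).
Local Notation mu := (@lebesgue_measure R).
Implicit Types (E F : set R) (f : R -> C).

Lemma normr_restr_indic E f t : `|restr_indic E f t| = (\1_E t : R) * `|f t|.
Proof. by rewrite normrZ ger0_norm. Qed.

Lemma measurable_restr_indic E f : measurable E ->
  measurable_fun E (fun t => complex.Re (f t)) ->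
  measurable_fun E (fun t => complex.Im (f t)) ->
  measurable_fun setT (fun t => `|restr_indic E f t|).
Proof.
move=> mE mRe mIm.
have -> : (fun t => `|restr_indic E f t|) = (fun t => `|f t|) \_ E.
  apply/funext => t; rewrite normr_restr_indic patchE indicE.
  by case: ifPn => _; rewrite ?mul1r ?mul0r.
apply/(measurable_restrictT _ _).1 => //.
have -> : (fun t => `|f t|) =
    Num.sqrt \o (fun t => complex.Re (f t) ^+ 2 + complex.Im (f t) ^+ 2).
  apply/funext => t; rewrite /Num.norm /= /ComplexField.Normc.normc /=.
  by case: (f t).
have msqrt : measurable_fun setT (Num.sqrt : R -> R).
  by apply: continuous_measurable_fun; exact: sqrt_continuous.
apply: (measurableT_comp msqrt).
by apply: measurable_funD; apply: measurable_funX.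
Qed.

Lemma LpC_norm_ge0 p f : (0 <= LpC_norm p f)%E.
Proof. exact: Lnorm_ge0. Qed.

End restr_indic_norm.

(** * Primitives of nonnegative integrable functions, as elements of [AC_r] *)

Section primitive.
Variables (R : realType) (h : R -> R).
Local Notation C := (Rcomplex R).
Local Notation mu := (@lebesgue_measure R).
Hypothesis h_ge0 : forall t, 0 <= h t.
Hypothesis h_int : mu.-integrable setT (EFin \o h).
Let G t := \int[mu]_(x in `[0, t]) h x.

Let h_intS (E : set R) : measurable E -> mu.-integrable E (EFin \o h).
Proof. by move=> mE; apply: integrableS h_int. Qed.

Lemma primitiveB u v : 0 <= u -> u <= v ->
  G v - G u = \int[mu]_(x in `]u, v[) h x.
Proof.
move=> u0 uv; rewrite /G Rintegral_itvB ?bnd_simp//; last exact: h_intS.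
by rewrite Rintegral_itv_bndo_bndc//; exact: h_intS.
Qed.

Lemma primitive_nondecreasing u v : 0 <= u -> u <= v -> G u <= G v.
Proof.
by move=> u0 uv; rewrite -subr_ge0 primitiveB// Rintegral_ge0.
Qed.

Lemma primitive_eq u v : 0 <= u -> u <= v ->
  (forall t, u < t -> t < v -> h t = 0) -> G v = G u.
Proof.
move=> u0 uv h0; apply/eqP; rewrite -subr_eq0 primitiveB//.
rewrite (@eq_Rintegral _ _ _ _ _ (cst 0)).
  by rewrite Rintegral_cst// mul0r.
by move=> t; rewrite inE/= in_itv/= => /andP[ut tv]; exact: h0.
Qed.

Lemma primitive_lower_bound u v a : 0 <= u -> u <= v -> 0 <= a ->
  (forall t, u < t -> t < v -> a <= h t) -> a * (v - u) <= G v.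
Proof.
move=> u0 uv a0 ah.
have Gu : 0 <= G u by apply: Rintegral_ge0.
rewrite (@le_trans _ _ (G v - G u))//; last by rewrite lerBlDr lerDl.
rewrite primitiveB//.
have -> : a * (v - u) = \int[mu]_(x in `]u, v[) cst a x.
  rewrite Rintegral_cst//. rewrite [X in fine X]lebesgue_measure_itv/= lte_fin.
  by move: uv; rewrite le_eqVlt => /predU1P[->|->]; rewrite ?ltxx ?subrr.
apply: le_Rintegral => //.
- apply/integrableP; split; first exact/measurable_EFinP/measurable_cst.
  rewrite (eq_integral (cst `|a|%:E))// integral_cst//=.
  rewrite [X in (_ * X)%E]lebesgue_measure_itv/=.
  by case: ifP => _; rewrite -?EFinD -?EFinM ?mule0 ltry.
- exact: h_intS.
- by move=> t /=; rewrite in_itv/= => /andP[]; exact: ah.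
Qed.

(** This is the absolute continuity of the integral: the increments of [G] add up to the integral of
    [h] over the union of the intervals, whose measure is the sum of their lengths by
    disjointness. *)
Lemma primitive_abs_continuous : abs_continuous 0 1 (fun t => G t *: (1 : C)).
Proof.
move=> e e0; have [d [d0 hd]] := integral_normr_continuous h_int e0.
exists d => // n u v uv tuv suv.
have mitv i : measurable (`]u i, v i[%classic : set R) by [].
have mU : measurable (\big[setU/set0]_(i < n) `]u i, v i[%classic : set R).
  exact: bigsetU_measurable.
have muU : (mu (\big[setU/set0]_(i < n) `]u i, v i[%classic : set R) < d%:E)%E.
  rewrite measure_semi_additive_ord//.
  rewrite (_ : (\sum_(i < n) _)%E = (\sum_(i < n) (v i - u i))%:E) ?lte_fin//.
  rewrite -sumEFin; apply: eq_bigr => i _.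
  rewrite [LHS]lebesgue_measure_itv/= lte_fin.
  have [_ [+ _]] := uv i.
  by rewrite le_eqVlt => /predU1P[->|->]; rewrite ?ltxx ?subrr.
apply: le_lt_trans (hd _ mU muU).
rewrite -lee_fin /Rintegral fineK; last first.
  apply: integrable_fin_num => //.
  have := h_intS mU => /integrable_abse.
  by apply: eq_integrable => // x _ /=.
rewrite ge0_integral_bigsetU//; last 3 first.
- exact: index_enum_uniq.
- by apply: sub_trivIset tuv.
- apply/measurable_EFinP; apply: measurableT_comp => //.
  by apply/measurable_EFinP; exact: measurable_int (h_intS mU).
rewrite -sumEFin; apply: lee_sum => i _.
have [ui0 [uvi _]] := uv i.
rewrite -scalerBl normrZ Rcomplex_norm1 mulr1 primitiveB//.
rewrite ger0_norm ?Rintegral_ge0// /Rintegral fineK; last first.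
  by apply: integrable_fin_num => //; exact: h_intS.
rewrite le_eqVlt; apply/orP; left; apply/eqP; apply: eq_integral => x _.
by rewrite /= ger0_norm.
Qed.

Hypothesis h_cont : forall t, 0 < t -> {for t, continuous h}.

(** Continuity of [h] is required only at positive points, because the bumps to which this applies
    accumulate at 0. *)
Lemma primitive_derive t : 0 < t ->
  derivable (fun t => G t *: (1 : C)) t 1 /\
  derive1 (fun t => G t *: (1 : C)) t = h t *: (1 : C).
Proof.
move=> t0.
have [dG <-] : derivable G t 1 /\ derive1 G t = h t.
  apply: (@continuous_FTC1_closed _ h 0 t (t + 1)) => //.
  - by rewrite ltrDl.
  - exact: h_intS.
  - exact: h_cont.
exact: derivable_scaler.
Qed.

Lemma AC_primitive (r : \bar R) : (1 <= r)%E -> ('N[mu]_r[EFin \o h] < +oo)%E ->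
  Defs.AC r (fun t => G t *: (1 : C)).
Proof.
move=> r1 hr; set f := fun t => _.
have mh : measurable_fun setT h.
  by apply/measurable_EFinP; exact: measurable_int h_int.
have ae0 : {ae mu, forall t : R, t != 0}.
  exists [set 0]; split => //; first exact: lebesgue_measure_set1.
  by move=> t /= /negP; rewrite negbK => /eqP.
have mRe : measurable_fun (`[0, 1]%classic : set R)
    (fun t => complex.Re (derive1 f t)).
  apply/measurable_fun_itv_obnd_cbndP.
  apply: (@eq_measurable_fun _ _ _ _ _ h) => [t|].
    rewrite inE/= in_itv/= => /andP[t0 _].
    by rewrite (primitive_derive t0).2 /= mulr1.
  exact: measurable_funTS.
have mIm : measurable_fun (`[0, 1]%classic : set R)
    (fun t => complex.Im (derive1 f t)).
  apply/measurable_fun_itv_obnd_cbndP.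
  apply: (@eq_measurable_fun _ _ _ _ _ (cst (0 : R))) => [t|].
    rewrite inE/= in_itv/= => /andP[t0 _].
    by rewrite (primitive_derive t0).2 /= mulr0.
  exact: measurable_cst.
split.
- by rewrite /f /G set_itv1 Rintegral_set1 scale0r.
- exact: primitive_abs_continuous.
- split.
    have := ae0; apply: filterS; first exact: (ae_filter_ringOfSetsType mu).
    move=> t t0; rewrite in_itv/= => /andP[t0' _].
    by have /primitive_derive[] : 0 < t by rewrite lt_neqAle eq_sym t0.
  split => //; apply: le_lt_trans hr.
  apply: ae_le_Lnorm => //; first exact: measurable_restr_indic.
  have := ae0; apply: filterS; first exact: (ae_filter_ringOfSetsType mu).
  move=> t t0; rewrite normr_id normr_restr_indic indicE.
  have [|_] := boolP (t \in _); last by rewrite mul0r.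
  rewrite mul1r inE/= in_itv/= => /andP[t0' _].
  have /primitive_derive[_ ->] : 0 < t by rewrite lt_neqAle eq_sym t0.
  by rewrite normrZ Rcomplex_norm1 mulr1.
Qed.

End primitive.

(** * Sums of disjoint bumps at geometrically decreasing scales *)

Section tents.
Variables (R : realType) (e : nat -> R) (s : R).
Local Notation mu := (@lebesgue_measure R).
Hypothesis e_gt0 : forall k, 0 < e k.
Hypothesis e_le1 : forall k, e k <= 1.
Hypothesis e_half : forall k, e k.+1 <= e k / 2.

(** The peak is 1 at 5/8, the support is [1/2, 3/4], and the value is at least 1/2 on
    [9/16, 11/16]. *)
Definition tent (x : R) : R := Num.max 0 (1 - `|16 * x - 10| / 2).

Definition bump k (t : R) : R :=
  (2 ^ (k + 1))%:R^-1 * e k `^ (s - 1) * tent (t / e k).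

(* At each [t > 0] only the finitely many bumps with [k < 1 / t] contribute. *)
Definition bump_sum (t : R) : R := \sum_(k < Num.truncn t^-1) bump k t.

Lemma tent_ge0 x : 0 <= tent x.
Proof. by rewrite /tent le_max lexx. Qed.

Lemma tent_le1 x : tent x <= 1.
Proof. by rewrite /tent ge_max ler01/= gerBl divr_ge0. Qed.

Lemma tent_continuous : continuous tent.
Proof.
move=> x; apply: (@continuous_max R R (fun=> 0)
    (fun x => 1 - `|16 * x - 10| / 2)).
  exact: cvg_cst.
apply: cvgB; first exact: cvg_cst.
apply: cvgM; last exact: cvg_cst.
apply: cvg_norm; apply: cvgB; last exact: cvg_cst.
by apply: cvgM; [exact: cvg_cst|exact: cvg_id].
Qed.

Lemma bump_ge0 k t : 0 <= bump k t.
Proof. by rewrite !mulr_ge0 ?tent_ge0 ?powR_ge0 ?invr_ge0. Qed.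

Lemma bump_le k t : bump k t <= (2 ^ (k + 1))%:R^-1 * e k `^ (s - 1).
Proof.
by rewrite ler_piMr ?tent_le1// mulr_ge0 ?powR_ge0 ?invr_ge0.
Qed.

Lemma bump_eq0 k t : t <= e k / 2 \/ 3 / 4 * e k <= t -> bump k t = 0.
Proof.
move=> H; rewrite /bump (_ : tent _ = 0) ?mulr0//.
apply/max_idPl; rewrite subr_le0 ler_pdivlMr// mul1r.
have ek := e_gt0 k.
case: H => H.
  have : t / e k <= 1 / 2 by rewrite ler_pdivrMr//; lra.
  by move=> ?; rewrite ler0_norm; lra.
have : 3 / 4 <= t / e k by rewrite ler_pdivlMr//; lra.
by move=> ?; rewrite ger0_norm; lra.
Qed.

Lemma bump_neq0 k t : bump k t != 0 -> e k / 2 < t /\ t < 3 / 4 * e k.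
Proof.
move=> H; split; rewrite ltNge; apply: contra_neqN H => ?; apply: bump_eq0.
  by left. by right.
Qed.

Lemma bump_ge_half k t : 9 / 16 * e k < t -> t < 11 / 16 * e k ->
  (2 ^ (k + 1))%:R^-1 * e k `^ (s - 1) / 2 <= bump k t.
Proof.
move=> t1 t2; rewrite /bump ler_wpM2l ?mulr_ge0 ?powR_ge0 ?invr_ge0//.
have ek := e_gt0 k.
rewrite /tent le_max; apply/orP; right.
have : 9 / 16 < t / e k by rewrite ltr_pdivlMr.
have : t / e k < 11 / 16 by rewrite ltr_pdivrMr.
move=> ? ?; suff : `|16 * (t / e k) - 10| <= 1 by lra.
by rewrite ler_norml; lra.
Qed.

Lemma bump_scale_decr j k : (j < k)%N -> e k <= e j / 2.
Proof.
elim: k => // k IH; rewrite ltnS leq_eqVlt => /predU1P[->//|/IH ?].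
have := e_half k; have := e_gt0 k; lra.
Qed.

(** A weak form of e_k <= 2^-k, enough to see that bump k vanishes at [t] once k + 1 > 1/t. *)
Lemma bump_scale_harmonic k : e k * k.+1%:R <= 1.
Proof.
elim: k => [|k IH]; first by rewrite mulr1.
apply: le_trans IH; have := e_half k; have := e_gt0 k.
have : (0 : R) <= k%:R by [].
rewrite -[k.+2%:R]natr1 -[k.+1%:R]natr1; nra.
Qed.

(** For j < k, bump k ends at 3/4 e_k <= 3/8 e_j, before bump j starts at e_j / 2. *)
Lemma bump_disjoint j k t : j != k -> bump j t != 0 -> bump k t = 0.
Proof.
move=> jk /bump_neq0[t1 t2]; apply/eqP; apply/negPn/negP => /bump_neq0[t3 t4].
have ej := e_gt0 j; have ek := e_gt0 k.
by move: jk; rewrite neq_ltn => /orP[] /bump_scale_decr; lra.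
Qed.

(** The freedom in [n] lets one finite sum represent [bump_sum] at several points at once. *)
Lemma bump_sumE n t : 0 < t -> t^-1 <= n%:R ->
  bump_sum t = \sum_(k < n) bump k t.
Proof.
move=> t0 tn; set N := Num.truncn t^-1.
have Nn : (N <= n)%N by rewrite truncn_le_nat (le_lt_trans tn)// ltr_nat.
rewrite /bump_sum -!(big_mkord xpredT (fun k => bump k t)).
rewrite [RHS](big_cat_nat _ Nn)//=.
rewrite [X in _ = _ + X]big_nat_cond [X in _ = _ + X]big1 ?addr0//.
move=> k /andP[/andP[+ _] _]; rewrite truncn_le_nat => tk.
apply: bump_eq0; right.
have := bump_scale_harmonic k; have ek := e_gt0 k.
have : 1 < k.+1%:R * t by rewrite -ltr_pdivrMr ?div1r.
have : (0 : R) < k.+1%:R by [].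
nra.
Qed.

Lemma bump_sum_ge0 t : 0 <= bump_sum t.
Proof. by apply: sumr_ge0 => k _; exact: bump_ge0. Qed.

Lemma bump_le_sum k t : bump k t <= bump_sum t.
Proof.
have [t0|t0] := leP t 0.
  by rewrite bump_eq0 ?bump_sum_ge0//; left; have := e_gt0 k; lra.
pose n := maxn k.+1 (Num.truncn t^-1).+1.
have kn : (k < n)%N by rewrite leq_max leqnn.
rewrite (@bump_sumE n)//; last first.
  by rewrite ltW// (lt_le_trans (truncnS_gt _))// ler_nat leq_max leqnn orbT.
rewrite (bigD1 (Ordinal kn))//= lerDl.
by apply: sumr_ge0 => ? _; exact: bump_ge0.
Qed.

Lemma bump_sum_eq t : bump_sum t = 0 \/ exists k, bump_sum t = bump k t.
Proof.
rewrite /bump_sum; set n := Num.truncn _.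
have [/existsP[k hk]|] := boolP [exists k : 'I_n, bump k t != 0].
  right; exists k; rewrite (bigD1 k)//= big1 ?addr0// => i ik.
  by apply: bump_disjoint hk; rewrite eq_sym.
rewrite negb_exists => /forallP h; left; rewrite big1// => k _.
by apply/eqP; have := h k; rewrite negbK.
Qed.

(** Such a [t] lies in the gap between the bumps: those of index at least k have already ended, and
    those of smaller index have not started. *)
Lemma bump_sum_eq0 k t : 3 / 4 * e k <= t ->
  (forall j, (j < k)%N -> t <= e j / 2) -> bump_sum t = 0.
Proof.
move=> kt jt; have [//|[j ->]] := bump_sum_eq t; apply: bump_eq0.
have [jk|kj] := ltnP j k; [by left; exact: jt|right].
have ej := e_gt0 j; have ek := e_gt0 k.
by move: kj; rewrite leq_eqVlt => /predU1P[<-//|/bump_scale_decr ?]; lra.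
Qed.

Lemma bump_continuous k : continuous (bump k).
Proof.
move=> t; apply: cvgM; first exact: cvg_cst.
apply: (@cvg_comp _ _ _ (fun x => x / e k) tent _ (nbhs (t / e k)));
  last exact: tent_continuous.
by apply: cvgM; [exact: cvg_id|exact: cvg_cst].
Qed.

Lemma bump_sum_continuous t : 0 < t -> {for t, continuous bump_sum}.
Proof.
(* This [n] exceeds 1/x for every x > t/2, so near [t] the sum is a fixed finite sum of continuous
   functions. *)
move=> t0; pose n := (Num.truncn (2 / t)).+1.
have H : \forall x \near t, \sum_(k < n) bump k x = bump_sum x.
  near=> x.
  have x0 : t / 2 < x by near: x; apply: lt_nbhsr; lra.
  rewrite (@bump_sumE n)//; first lra.
  rewrite (le_trans _ (ltW (truncnS_gt _)))//.
  rewrite -[leRHS]invf_div lef_pV2 ?posrE; lra.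
suff : (fun x => \sum_(k < n) bump k x) x @[x --> t] --> bump_sum t.
  by move=> S; apply: cvg_trans S; exact: near_eq_cvg.
rewrite -(nbhs_singleton H).
elim: n {H} => [|n IH].
  by under eq_fun do rewrite big_ord0; rewrite big_ord0; exact: cvg_cst.
under eq_fun do rewrite big_ord_recr; rewrite big_ord_recr /=.
by apply: cvgD => //; exact: bump_continuous.
Unshelve. all: by end_near. Qed.

Lemma measurable_bump_sum : measurable_fun setT bump_sum.
Proof.
have -> : [set: R] = `]-oo, 0] `|` `]0, +oo[.
  by rewrite -setCitvr setvU.
apply/measurable_funU => //; split.
  apply: (@eq_measurable_fun _ _ _ _ _ (cst (0 : R)));
    last exact: measurable_cst.
  move=> t; rewrite inE/= in_itv/= => t0.
  rewrite /bump_sum big1// => k _; rewrite bump_eq0//.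
  by left; have := e_gt0 k; lra.
apply: open_continuous_measurable_fun; first exact: interval_open.
move=> t; rewrite inE/= in_itv/= andbT; exact: bump_sum_continuous.
Qed.

(** As e_k <= 1 and (s - 1) q >= -1, e_k^((s - 1) q) <= e_k^-1. The bound on the right integrates to
    2^-(k+1). The condition on [q] covers q = 1 when s >= 0, and q = r when s = 1 - 1/r. *)
Lemma powR_bump_le q k t : 1 <= q -> (1 - s) * q <= 1 ->
  bump k t `^ q <= (2 ^ (k + 1))%:R^-1 / e k * \1_(`]0, e k[%classic : set R) t.
Proof.
move=> q1 sq; have q0 : 0 < q by lra.
have ek := e_gt0 k.
rewrite indicE; have [_|] := boolP (t \in _); last first.
  rewrite notin_setE /= in_itv/= => /negP; rewrite negb_and -!leNgt => tn.
  rewrite bump_eq0; first by rewrite powR0 ?mulr0// gt_eqF.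
  by case/orP: tn => tn; [left|right]; lra.
rewrite mulr1.
apply: (@le_trans _ _ (((2 ^ (k + 1))%:R^-1 * e k `^ (s - 1)) `^ q)).
  apply: ge0_ler_powR; rewrite ?nnegrE ?bump_ge0 ?bump_le ?(ltW q0)//.
  by rewrite mulr_ge0 ?powR_ge0 ?invr_ge0.
rewrite powRM ?powR_ge0 ?invr_ge0// ler_pM ?powR_ge0//.
  rewrite -[leRHS]powRr1 ?invr_ge0//.
  apply: ger_powR => //; rewrite invr_gt0 ltr0n expn_gt0/=.
  by rewrite invf_le1 ?ler1n ?ltr0n expn_gt0.
rewrite -powRrM -powR_inv1 ?(ltW ek)//.
apply: ger_powR; first by rewrite ek e_le1.
lra.
Qed.

Lemma integral_bump_sum_le q : 1 <= q -> (1 - s) * q <= 1 ->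
  (\int[mu]_t (bump_sum t `^ q)%:E <= 1)%E.
Proof.
move=> q1 sq; have q0 : 0 < q by lra.
pose B k (t : R) : \bar R :=
  ((2 ^ (k + 1))%:R^-1 / e k * \1_(`]0, e k[%classic : set R) t)%:E.
have B0 k t : (0 <= B k t)%E.
  by rewrite lee_fin !mulr_ge0 ?invr_ge0// ltW// e_gt0.
have mB k : measurable_fun setT (B k).
  apply/measurable_EFinP; apply: measurable_funM => //.
have intB k : (\int[mu]_t B k t = (1 / (2 ^ (k + 1))%:R)%:E)%E.
  under eq_integral do rewrite /B EFinM.
  rewrite ge0_integralZl//; last 2 first.
  - by apply/measurable_EFinP.
  - by rewrite lee_fin divr_ge0 ?invr_ge0// ltW.
  rewrite integral_indic//= setIT.
  rewrite [X in (_ * X)%E]lebesgue_measure_itv/= lte_fin e_gt0.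
  by rewrite -EFinD -EFinM subr0 divfK ?gt_eqF// div1r.
apply: (@le_trans _ _ (\int[mu]_t (\sum_(0 <= k <oo) B k t))%E).
  apply: ge0_le_integral => //.
  - by move=> t _; rewrite lee_fin powR_ge0.
  - apply/measurable_EFinP; apply: (measurableT_comp (measurable_powR q)).
    exact: measurable_bump_sum.
  - by apply: (@ge0_emeasurable_sum _ _ _ _ B xpredT).
  (* By disjointness the power of the sum is the power of a single bump, dominated by one term of
     the series. *)
  - move=> t _; have [->|[k ->]] := bump_sum_eq t.
      by rewrite powR0 ?gt_eqF// nneseries_ge0.
    rewrite (nneseriesD1 (n := k))//.
    apply: (@le_trans _ _ (B k t)); first by rewrite lee_fin powR_bump_le.
    by rewrite leeDl// nneseries_ge0.
rewrite integral_nneseries//.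
under eq_eseriesr do rewrite intB.
have /cvg_lim := @cvg_geometric_eseries_half R 1 0.
by rewrite expr0 divr1 => ->.
Qed.

End tents.

(** * The exponent 1/r' *)

Section conjugate_exponent.
Variable R : realType.
Implicit Type r : \bar R.

Definition conj_exponent r : R := (fine (hoelder_conjugate r))^-1.

Lemma conj_exponenty : conj_exponent +oo%E = 1.
Proof. by rewrite /conj_exponent hoelder_conjugatey invr1. Qed.

Lemma conj_exponent_EFin (q : R) : 1 < q -> conj_exponent q%:E = 1 - q^-1.
Proof.
move=> q1; have q0 : q != 0 by lra.
rewrite /conj_exponent /hoelder_conjugate/= eqe (negbTE q0).
rewrite -EFinB inver ifF ?subr_eq0; last by apply/negbTE; lra.
by rewrite -EFinM /= invf_div mulrBl divff// mul1r.
Qed.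

Lemma conj_exponent_itv r : (1 < r)%E -> 0 <= conj_exponent r <= 1.
Proof.
case: r => [q|_|//]; last by rewrite conj_exponenty ler01 lexx.
rewrite lte_fin => q1; rewrite conj_exponent_EFin//.
have : 0 < q^-1 by rewrite invr_gt0; lra.
have : q^-1 <= 1 by rewrite invf_le1; lra.
lra.
Qed.

End conjugate_exponent.

(** * The test function: a primitive of the bumps *)

Section staircase.
Variables (R : realType) (e : nat -> R) (r : \bar R).
Local Notation C := (Rcomplex R).
Local Notation mu := (@lebesgue_measure R).
Hypothesis e_gt0 : forall k, 0 < e k.
Hypothesis e_le1 : forall k, e k <= 1.
Hypothesis e_half : forall k, e k.+1 <= e k / 2.
Hypothesis r_gt1 : (1 < r)%E.
Local Notation s := (conj_exponent r).
Local Notation h := (bump_sum e s).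

(** The primitive [G] of the overview; it rises only across the bumps. *)
Definition staircase (t : R) : R := \int[mu]_(x in `[0, t]) h x.

Let s_le1 : s <= 1. Proof. by have /andP[] := conj_exponent_itv r_gt1. Qed.
Let s_ge0 : 0 <= s. Proof. by have /andP[] := conj_exponent_itv r_gt1. Qed.

Lemma bump_sum_integrable : mu.-integrable setT (EFin \o h).
Proof.
apply/integrableP; split.
  by apply/measurable_EFinP; exact: measurable_bump_sum.
apply: (@le_lt_trans _ _ 1%E); last exact: ltry.
have := @integral_bump_sum_le R e s e_gt0 e_le1 e_half 1 (lexx 1).
rewrite mulr1 lerBlDr lerDl => /(_ s_ge0); apply: le_trans.
rewrite le_eqVlt; apply/orP; left; apply/eqP; apply: eq_integral => x _.
by rewrite /= powRr1 ?ger0_norm// bump_sum_ge0.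
Qed.

(** For finite [r] this is the integral bound at q = r, where (1 - s) r = 1. For [r = +oo], s = 1
    and every bump is bounded by 2^-(k+1). *)
Lemma bump_sum_Lnorm : ('N[mu]_r[EFin \o h] < +oo)%E.
Proof.
case: r r_gt1 => [q|_|//].
  rewrite lte_fin => q1; have q0 : 0 < q by lra.
  rewrite unlock; apply: poweR_lty.
  apply: (@le_lt_trans _ _ 1%E); last exact: ltry.
  apply: le_trans _ (@integral_bump_sum_le R e _ e_gt0 e_le1 e_half q _ _).
  - rewrite le_eqVlt; apply/orP; left; apply/eqP; apply: eq_integral => x _.
    by rewrite /= ger0_norm// bump_sum_ge0.
  - exact: ltW.
  - by rewrite conj_exponent_EFin// opprB addrC subrK mulVf// gt_eqF.
rewrite conj_exponenty unlock; case: ifPn => // _.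
apply: (@le_lt_trans _ _ 1%E); last exact: ltry.
apply/ess_supP; apply: (@filterE _ _ (ae_filter_ringOfSetsType mu)) => x /=.
rewrite lee_fin ger0_norm ?bump_sum_ge0//.
have [->|[k ->]] := bump_sum_eq 1 e_gt0 e_half x; first exact: ler01.
apply: le_trans (bump_le _ _ _ _) _.
rewrite subrr powRr0 mulr1 invf_le1 ?ler1n ?ltr0n expn_gt0//.
Qed.

Lemma AC_staircase : Defs.AC r (fun t => staircase t *: (1 : C)).
Proof.
apply: AC_primitive.
- by move=> t; exact: bump_sum_ge0.
- exact: bump_sum_integrable.
- by move=> t; exact: bump_sum_continuous.
- exact: ltW.
- exact: bump_sum_Lnorm.
Qed.

(** Both values equal the one at 3/4 e_k, where bump k ends. For k = 0 the second condition is
    vacuous: the function is constant from there on. *)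
Lemma staircase_flat k t : 3 / 4 * e k < t ->
  (forall j, (j < k)%N -> t <= e j / 2) -> staircase t = staircase (e k).
Proof.
have ek := e_gt0 k.
have H u : 3 / 4 * e k <= u -> (forall j, (j < k)%N -> u <= e j / 2) ->
    staircase u = staircase (3 / 4 * e k).
  move=> ku uj; apply: primitive_eq => //.
  - exact: bump_sum_integrable.
  - lra.
  - move=> x kx xu; apply: (@bump_sum_eq0 _ _ _ e_gt0 e_half k).
      exact: ltW.
    by move=> j jk; rewrite (le_trans (ltW xu))// uj.
move=> kt tj; rewrite H ?(ltW kt)// H//; first lra.
by move=> j; exact: bump_scale_decr.
Qed.

Lemma staircase_lower k :
  (2 ^ (k + 1))%:R^-1 * e k `^ s / 16 <= staircase (e k).
Proof.
have ek := e_gt0 k.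
set w : R := (2 ^ (k + 1))%:R^-1.
have w0 : 0 <= w by rewrite invr_ge0.
(* On the middle part of bump k, of length e_k / 8, the height is at least half of the maximal one;
   the integral over it gives the constant 1/16. *)
have -> : w * e k `^ s / 16 =
    (w * e k `^ (s - 1) / 2) * (11 / 16 * e k - 9 / 16 * e k).
  have -> : e k `^ s = e k `^ (s - 1) * e k.
    rewrite -{3}[e k]powRr1 ?(ltW ek)// -powRD ?subrK//.
    by rewrite (gt_eqF ek) implybT.
  by field.
apply: (@le_trans _ _ (staircase (11 / 16 * e k))).
  apply: primitive_lower_bound.
  - by move=> x; exact: bump_sum_ge0.
  - exact: bump_sum_integrable.
  - lra.
  - lra.
  - by rewrite !mulr_ge0 ?powR_ge0.
  - move=> x x1 x2; apply: (@le_trans _ _ (bump e s k x)).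
      exact: bump_ge_half.
    exact: bump_le_sum.
apply: primitive_nondecreasing.
- by move=> x; exact: bump_sum_ge0.
- exact: bump_sum_integrable.
- lra.
- lra.
Qed.

Lemma staircase_gt0 k : 0 < staircase (e k).
Proof.
apply: lt_le_trans (staircase_lower k).
by rewrite !mulr_gt0 ?powR_gt0// invr_gt0 ltr0n expn_gt0.
Qed.

End staircase.

(** * Comparison and subadditivity of norms of complex-valued functions *)

Section LpC_norm_comparison.
Variables (R : realType) (p : R).
Local Notation C := (Rcomplex R).
Local Notation mu := (@lebesgue_measure R).
Hypothesis p_ge1 : 1 <= p.
Implicit Types (E F : set R) (f g : R -> C).

Lemma LpC_norm_le_scale (a : R) E F f g : 0 <= a ->
  measurable_fun setT (fun t => `|restr_indic E f t|) ->
  measurable_fun setT (fun t => `|restr_indic F g t|) ->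
  (forall t, E t -> F t /\ `|f t| <= a * `|g t|) ->
  (LpC_norm p%:E (restr_indic E f) <= a%:E * LpC_norm p%:E (restr_indic F g))%E.
Proof.
move=> a0 mE mF fg; rewrite -Lnorm_scale//.
apply: ae_le_Lnorm => //; first exact: measurable_funM.
apply: (@filterE _ _ (ae_filter_ringOfSetsType mu)) => t.
rewrite normr_id ger0_norm ?mulr_ge0// !normr_restr_indic !indicE.
have [|_] := boolP (t \in E); last by rewrite mul0r !mulr_ge0.
by rewrite inE => /fg[Ft]; rewrite mem_set// !mul1r.
Qed.

Lemma LpC_norm_le_setU E F f :
  measurable_fun setT (fun t => `|restr_indic (E `|` F) f t|) ->
  measurable_fun setT (fun t => `|restr_indic E f t|) ->
  measurable_fun setT (fun t => `|restr_indic F f t|) ->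
  (LpC_norm p%:E (restr_indic (E `|` F) f) <=
   LpC_norm p%:E (restr_indic E f) + LpC_norm p%:E (restr_indic F f))%E.
Proof.
move=> mEF mE mF.
apply: le_trans (eminkowski mu mE mF _); last by rewrite lee_fin.
apply: ae_le_Lnorm => //; first exact: measurable_funD.
apply: (@filterE _ _ (ae_filter_ringOfSetsType mu)) => t /=.
rewrite normr_id ger0_norm ?addr_ge0// !normr_restr_indic !indicE.
rewrite in_setU -mulrDl ler_wpM2r//.
by case: (t \in E); case: (t \in F) => /=; lra.
Qed.

End LpC_norm_comparison.

(** * Differentiating [m G] where [G] is constant *)

Section flat_multiplier.
Variables (R : realType) (m : R -> Rcomplex R) (G : R -> R) (c a b t : R).
Hypothesis G_flat : forall x, a < x -> x < b -> G x = c.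
Hypotheses (c_neq0 : c != 0) (a_ge0 : 0 <= a) (at_lt : a < t) (tb_lt : t < b).
Local Notation mG := (mult_op m (fun t => G t *: (1 : Rcomplex R))).

(** Since [t] is interior to the flat interval, the identity holds on a neighbourhood, hence passes
    to two-sided derivatives; [a_ge0] selects the branch 0 < x of [mult_op]. *)
Let near_flat : \forall x \near t, mG x = c *: m x.
Proof.
near=> x; have ax : a < x by near: x; exact: lt_nbhsr.
rewrite /mult_op (le_lt_trans a_ge0 ax) G_flat//; last first.
  by near: x; exact: lt_nbhsl.
by rewrite mulrC -scalerAl mul1r.
Unshelve. all: by end_near. Qed.

Lemma derive1_mult_op_flat : derive1 mG t = c *: derive1 m t.
Proof. by rewrite (near_eq_derive1 near_flat) derive1_scale. Qed.

Lemma derivable_mult_op_flat : derivable mG t 1 -> derivable m t 1.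
Proof.
by move=> /(near_eq_derivable near_flat) dcm; apply: derivable_scale dcm.
Qed.

End flat_multiplier.

(** * Regularity of the multiplier and the growth bound *)

Section multiplier_bound.
Variables (R : realType) (p : R) (r : \bar R) (m : R -> Rcomplex R).
Local Notation mu := (@lebesgue_measure R).
Local Notation s := (conj_exponent r).
Hypothesis p_ge1 : 1 <= p.
Hypothesis r_gt1 : (1 < r)%E.
Hypothesis m_mult : forall g, Defs.AC r g -> Defs.AC p%:E (mult_op m g).

(** With e_0 = eps, the staircase is a positive constant [c] on all of ]3/4 eps, +oo[, so there [m]
    is a constant multiple of [f], an element of [AC_p]. *)
Lemma multiplier_local eps : 0 < eps -> eps < 1 ->
  abs_continuous eps 1 m /\ deriv_in_Lp p%:E eps 1 m.
Proof.
move=> eps0 eps1.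
pose e k : R := eps / 2 ^+ k.
have e_gt0 k : 0 < e k by rewrite divr_gt0// exprn_gt0.
have e_half k : e k.+1 <= e k / 2 by rewrite /e exprSr invfM mulrA.
have e_le1 k : e k <= 1.
  elim: k => [|k IH]; first by rewrite /e expr0 divr1 ltW.
  by have := e_half k; have := e_gt0 k; lra.
have [f0 fAC [fD [fRe fIm fL]]] :=
  m_mult (AC_staircase e_gt0 e_le1 e_half r_gt1).
set f := mult_op m _ in f0 fAC fD fRe fIm fL.
set c := staircase e r eps.
have e0 : e 0%N = eps by rewrite /e expr0 divr1.
have c0 : 0 < c by rewrite /c -e0; exact: staircase_gt0.
have flat x : 3 / 4 * eps < x -> staircase e r x = c.
  rewrite -e0 => /(staircase_flat e_gt0 e_le1 e_half r_gt1).
  by rewrite e0; apply.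
(* Any right end beyond [t] would do, as no bump lies to the right of the first one. *)
have flat' t x : 3 / 4 * eps < x -> x < t + 1 -> staircase e r x = c.
  by move=> + _; exact: flat.
have a0 : 0 <= 3 / 4 * eps by lra.
have fm t : eps <= t -> f t = c *: m t.
  move=> et; rewrite /f /mult_op (lt_le_trans eps0 et) flat; last lra.
  by rewrite mulrC -scalerAl mul1r.
(* The flat part begins strictly to the left of eps, so t = eps is included. *)
have Dfm t : eps <= t -> derive1 f t = c *: derive1 m t.
  move=> et; rewrite /f; apply: (derive1_mult_op_flat m (flat' t)) => //;
    last lra.
    by rewrite gt_eqF.
  lra.
have dfm t : eps <= t -> derivable f t 1 -> derivable m t 1.
  move=> et; apply: (derivable_mult_op_flat (flat' t)) => //; last lra.
    by rewrite gt_eqF.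
  lra.
have sub01 : `[eps, 1%R]%classic `<=` (`[0, 1]%classic : set R).
  by apply: subset_itvr; rewrite bnd_simp ltW.
have mRe : measurable_fun (`[eps, 1%R]%classic : set R)
    (fun t => complex.Re (derive1 m t)).
  apply: (@eq_measurable_fun _ _ _ _ _
      (fun t => c^-1 * complex.Re (derive1 f t))).
    move=> t; rewrite inE/= in_itv/= => /andP[/Dfm -> _].
    by rewrite linearZ/= mulKf ?gt_eqF.
  by apply: measurable_funM => //; exact: measurable_funS fRe.
have mIm : measurable_fun (`[eps, 1%R]%classic : set R)
    (fun t => complex.Im (derive1 m t)).
  apply: (@eq_measurable_fun _ _ _ _ _
      (fun t => c^-1 * complex.Im (derive1 f t))).
    move=> t; rewrite inE/= in_itv/= => /andP[/Dfm -> _].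
    by rewrite linearZ/= mulKf ?gt_eqF.
  by apply: measurable_funM => //; exact: measurable_funS fIm.
split; last split; last split => //.
- move=> x x0; have [d d0 hd] := fAC (c * x) (mulr_gt0 c0 x0).
  exists d => // n u v uv tuv suv.
  rewrite -(ltr_pM2l c0) mulr_sumr.
  have uv' i : 0 <= u i /\ u i <= v i /\ v i <= 1.
    by have [? [? ?]] := uv i; split=> //; lra.
  apply: le_lt_trans (hd n u v uv' tuv suv).
  apply: ler_sum => i _; have [ui [uvi vi]] := uv i.
  by rewrite !fm ?(le_trans ui)// -scalerBr normrZ gtr0_norm.
- have := fD; apply: filterS; first exact: (ae_filter_ringOfSetsType mu).
  move=> t dft; rewrite in_itv/= => /andP[et t1]; apply: dfm => //.
  by apply: dft; rewrite in_itv/= t1 andbT; lra.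
- apply: (@le_lt_trans _ _
      (c^-1%:E *
       LpC_norm p%:E (restr_indic `[0%R, 1%R]%classic (derive1 f)))%E).
    apply: LpC_norm_le_scale => //.
    + by rewrite invr_ge0 ltW.
    + exact: measurable_restr_indic.
    + exact: measurable_restr_indic.
    + move=> t /[dup]/sub01 t01 /=; rewrite in_itv/= => /andP[et _].
      split => //.
      by rewrite Dfm// normrZ gtr0_norm// mulKf ?gt_eqF.
  by rewrite lte_mul_pinfty ?lee_fin ?invr_ge0 ?(ltW c0).
Qed.

Lemma measurable_restr_derive1 a (E : set R) : 0 < a -> a < 1 -> measurable E ->
  E `<=` `[a, 1%R]%classic ->
  measurable_fun setT (fun t => `|restr_indic E (derive1 m) t|).
Proof.
move=> a0 a1 mE Ea; have [_ [_ [mRe mIm _]]] := multiplier_local a0 a1.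
by apply: measurable_restr_indic => //; [move: mRe|move: mIm];
  apply: measurable_funS.
Qed.

(** One test function serves all scales, so [v], the norm of (m G)', does not depend on [k]. The
    interval starts after the end of bump k + 1 and excludes e_k / 2, where bump k starts and the
    two-sided derivative is no longer controlled. *)
Lemma multiplier_gliding_hump (e : nat -> R) :
  (forall k, 0 < e k) -> (forall k, e k < 1) -> (forall k, e k.+1 < e k / 2) ->
  exists v : R, forall k,
    (LpC_norm p%:E (restr_indic `[e k.+1, (e k / 2)%R[%classic (derive1 m)) <=
      (16 * 2 ^+ k.+2 * e k.+1 `^ (- s) * v)%:E)%E.
Proof.
move=> e_gt0 e_lt1 e_lt.
have e_le1 k : e k <= 1 by exact: ltW.
have e_half k : e k.+1 <= e k / 2 by exact: ltW.
have [f0 fAC [fD [fRe fIm fL]]] :=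
  m_mult (AC_staircase e_gt0 e_le1 e_half r_gt1).
set f := mult_op m _ in f0 fAC fD fRe fIm fL.
set V := LpC_norm _ _ in fL.
have V0 : (0 <= V)%E by exact: LpC_norm_ge0.
have Vfin : (fine V)%:E = V by rewrite fineK// ge0_fin_numE.
exists (fine V) => k; set c := staircase e r (e k.+1).
have ek := e_gt0 k; have ek1 := e_gt0 k.+1; have elt := e_lt k.
have el1 := e_lt1 k.
have c0 : 0 < c by exact: staircase_gt0.
have flat x : 3 / 4 * e k.+1 < x -> x < e k / 2 -> staircase e r x = c.
  move=> x1 x2; apply: staircase_flat => // j; rewrite ltnS leq_eqVlt.
  by move=> /predU1P[->|/(bump_scale_decr e_gt0 e_half) ?]; lra.
have Dfm t : e k.+1 <= t -> t < e k / 2 -> derive1 f t = c *: derive1 m t.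
  move=> t1 t2; rewrite /f; apply: (derive1_mult_op_flat m flat) => //.
  - by rewrite gt_eqF.
  - lra.
  - lra.
apply: (@le_trans _ _ (c^-1%:E * V)%E).
  apply: LpC_norm_le_scale => //.
  - by rewrite invr_ge0 ltW.
  - apply: (@measurable_restr_derive1 (e k.+1)) => //.
    by move=> t /=; rewrite !in_itv/= => /andP[-> ?]; lra.
  - exact: measurable_restr_indic.
  - move=> t /=; rewrite !in_itv/= => /andP[t1 t2]; split; first lra.
    by rewrite Dfm// normrZ gtr0_norm// mulKf ?gt_eqF.
rewrite -Vfin -EFinM lee_fin ler_wpM2r ?fine_ge0//.
have lb := staircase_lower e_gt0 e_le1 e_half r_gt1 k.+1.
(* The constant is the inverse of the lower bound for the staircase at e_{k+1}. *)
rewrite (_ : _ * _ = ((2 ^ (k.+1 + 1))%:R^-1 * e k.+1 `^ s / 16)^-1).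
  rewrite lef_pV2 ?posrE//.
  by rewrite !mulr_gt0 ?powR_gt0// invr_gt0 ltr0n expn_gt0.
rewrite !invfM !invrK powRN natrX addn1 -mulrA.
by rewrite [LHS]mulrC [LHS]mulrA [LHS]mulrC.
Qed.

Lemma multiplier_bound : exists A : R, forall eps : R, 0 < eps -> eps < 1 ->
  (LpC_norm p%:E (restr_indic `[eps, 1%R]%classic (derive1 m)) <=
    (A * eps `^ (- s))%:E)%E.
Proof.
pose N (E : set R) := LpC_norm p%:E (restr_indic E (derive1 m)).
apply: contrapT => /forallNP unbounded.
have powR_ge1 (x : R) : 0 < x -> x < 1 -> 1 <= x `^ (- s).
  move=> x0 x1; rewrite powRN -[leLHS]invr1 lef_pV2 ?posrE ?powR_gt0//.
  rewrite -(powRr0 x); apply: ger_powR; first by rewrite x0 ltW.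
  by have /andP[] := conj_exponent_itv r_gt1.
(* The next scale, below a prescribed [a], with a prescribed constant [B]. The conditions sit under
   the existential so that a choice function is defined on all pairs; 0 is a dummy value where they
   fail. *)
have step (aB : R * R) : exists x : R, 0 < aB.1 -> aB.1 < 1 -> 0 <= aB.2 ->
    [/\ 0 < x, x < aB.1 & ((aB.2 * x `^ (- s))%:E < N `[x, aB.1[%classic)%E].
  case: aB => a B /=.
  have [[a0 [a1 B0]]|H] := pselect (0 < a /\ a < 1 /\ 0 <= B); last first.
    by exists 0 => ? ? ?; exfalso; apply: H.
  have [_ [_ [_ _ Nlt]]] := multiplier_local a0 a1.
  have Na0 : (0 <= N `[a, 1%R]%classic)%E by exact: LpC_norm_ge0.
  have Na : (fine (N `[a, 1%R]%classic))%:E = N `[a, 1%R]%classic.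
    by rewrite fineK// ge0_fin_numE.
  set n := fine _ in Na; have n0 : 0 <= n by rewrite fine_ge0.
  (* Adding [n], the norm on [a, 1], to [B] compensates for that part: as x^-s >= 1, an excess over
     (B + n) x^-s on [x, 1] leaves an excess over B x^-s on [x, a[. *)
  have /existsNP[x /not_implyP[x0 /not_implyP[x1 /negP]]] := unbounded (B + n).
  rewrite -ltNge => Nx.
  have xs1 := powR_ge1 x x0 x1.
  have mx E : measurable E -> E `<=` `[x, 1%R]%classic ->
      measurable_fun setT (fun t => `|restr_indic E (derive1 m) t|).
    exact: measurable_restr_derive1.
  (* If a <= x, the norm on [x, 1] would be at most n <= (B + n) x^-s. *)
  have xa : x < a.
    rewrite ltNge; apply/negP => ax; move: Nx; apply/negP; rewrite -leNgt.
    apply: (@le_trans _ _ (1%:E * N `[a, 1%R]%classic)%E).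
      apply: LpC_norm_le_scale => //.
      - exact: mx.
      - exact: (@measurable_restr_derive1 a).
      - move=> t /=; rewrite !in_itv/= mul1r => /andP[xt ->]; split => //.
        by rewrite (le_trans ax).
    rewrite mul1e -Na lee_fin; nra.
  exists x => _ _ _; split => //.
  have sxa : `[x, a[ `|` `[a, 1%R] = `[x, 1%R]%classic :> set R.
    rewrite -itv_bndbnd_setU// bnd_simp ltW//.
  have : (N `[x, 1%R]%classic <= N `[x, a[%classic + N `[a, 1%R]%classic)%E.
    rewrite -sxa; apply: LpC_norm_le_setU => //.
    - by rewrite sxa; exact: mx.
    - by apply: mx => // t /=; rewrite !in_itv/= => /andP[-> ?]; lra.
    - exact: (@measurable_restr_derive1 a).
  move=> /(lt_le_trans Nx); rewrite -Na -lteBlDr// -EFinB.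
  by apply: le_lt_trans; rewrite lee_fin; nra.
have [F hF] := choice step.
(* The factor 16 * 2^(j+2) cancels the one in the gliding hump estimate, leaving j + 1 against [v];
   the first scale 1/2 is an arbitrary point of ]0, 1[. *)
pose e := fix e k : R := if k is j.+1 then F (e j / 2, 16 * 2 ^+ j.+2 * j.+1%:R)
  else 1 / 2.
have B0 k : 0 <= 16 * 2 ^+ k.+2 * k.+1%:R :> R.
  by rewrite -natrX -!natrM.
have e01 k : 0 < e k /\ e k < 1.
  elim: k => [|k [IH0 IH1]]; first by split => /=; lra.
  have a0 : 0 < e k / 2 by lra.
  have a1 : e k / 2 < 1 by lra.
  have [x0 x1 _] := hF (_, _) a0 a1 (B0 k); split; first exact: x0.
  by apply: lt_trans x1 _.
have eP k : e k.+1 < e k / 2 /\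
    ((16 * 2 ^+ k.+2 * k.+1%:R * e k.+1 `^ (- s))%:E <
      N `[e k.+1, (e k / 2)%R[%classic)%E.
  have [IH0 IH1] := e01 k.
  have a0 : 0 < e k / 2 by lra.
  have a1 : e k / 2 < 1 by lra.
  by have [] := hF (_, _) a0 a1 (B0 k).
have [v hv] := multiplier_gliding_hump (fun k => (e01 k).1) (fun k => (e01 k).2)
  (fun k => (eP k).1).
(* At this index, one more than the integer part of [v] would be less than [v]. *)
have := lt_le_trans (eP (Num.truncn v)).2 (hv _); rewrite lte_fin.
rewrite -mulrA [_ * _ `^ _]mulrC mulrA ltr_pM2l.
  by rewrite ltNge ltW// truncnS_gt.
apply: mulr_gt0; first by rewrite mulr_gt0 ?exprn_gt0.
by apply: powR_gt0; exact: (e01 _).1.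
Qed.

End multiplier_bound.

Theorem theorem5 (R : realType) (p r : \bar R) (hp : (1 <= p)%E)
    (hpr : (p < r)%E) (m : R -> Rcomplex R) (hm : multiplier r p m) :
  (forall eps : R, 0 < eps -> eps < 1 ->
     abs_continuous eps 1 m /\ deriv_in_Lp p eps 1 m) /\
  exists A : R, forall eps : R, 0 < eps -> eps < 1 ->
    (LpC_norm p (restr_indic `[eps, 1%R]%classic (derive1 m))
       <= (A * eps `^ (- (fine (hoelder_conjugate r))^-1))%:E)%E.
Proof.
have r1 : (1 < r)%E by exact: le_lt_trans hpr.
have [_ hmult] := hm.
(* The strict inequality p < r forces [p] to be finite. *)
case: p hp hpr hm hmult => [p| |//]; last by move=> _; rewrite ltNge leey.
rewrite lee_fin => p1 _ _ hmult; split.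
  exact: (multiplier_local p1 r1 hmult).
exact: (multiplier_bound p1 r1 hmult).
Qed.
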